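(* Let $X$ be a topological space. (1) If $X$ is Lindelöf and $X$ is a union of fewer than $\mathfrak{d}$ star-Hurewicz subspaces, then $X$ is star-Scheepers. (2) If $X$ is star-Lindelöf and $X$ is a union of fewer than $\mathfrak{d}$ Hurewicz subspaces, then $X$ is star-Scheepers.
   Context: For $A\subseteq X$ and a family $\mathcal{P}$ of subsets of $X$, $St(A,\mathcal{P})=\bigcup\{B\in\mathcal{P} : A\cap B\neq\emptyset\}$. $X$ is star-Lindelöf if for every open cover $\mathcal{U}$ of $X$ there is a countable $\mathcal{V}\subseteq\mathcal{U}$ with $St(\bigcup\mathcal{V},\mathcal{U})=X$. An $\omega$-cover of $X$ is an open cover $\mathcal{U}$ such that every finite $F\subseteq X$ is contained in some member of $\mathcal{U}$. $X$ is star-Scheepers if for each sequence $(\mathcal{U}_n)_{n\in\mathbb{N}}$ of open covers of $X$ there are finite $\mathcal{V}_n\subseteq\mathcal{U}_n$ such that $\{St(\bigcup\mathcal{V}_n,\mathcal{U}_n) : n\in\mathbb{N}\}$ is an $\omega$-cover of $X$ or $St(\bigcup\mathcal{V}_n,\mathcal{U}_n)=X$ for some $n$. A space $X$ is Hurewicz (respectively, star-Hurewicz) if for each sequence $(\mathcal{U}_n)_{n\in\mathbb{N}}$ of open covers of $X$ there are finite $\mathcal{V}_n\subseteq\mathcal{U}_n$ such that each $x\in X$ belongs to $\bigcup\mathcal{V}_n$ (respectively, to $St(\bigcup\mathcal{V}_n,\mathcal{U}_n)$) for all but finitely many $n$, or $\bigcup\mathcal{V}_n=X$ (respectively, $St(\bigcup\mathcal{V}_n,\mathcal{U}_n)=X$)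 for some $n$ (these are the selection principles $U_{fin}(\mathcal{O},\Gamma)$ and $U^{*}_{fin}(\mathcal{O},\Gamma)$). $\mathfrak{d}$ is the minimum cardinality of a dominating subset of $\mathbb{N}^{\mathbb{N}}$, where $D$ is dominating if for every $g\in\mathbb{N}^{\mathbb{N}}$ there is $f\in D$ with $g(n)\leq f(n)$ for all but finitely many $n$. *)

(* Defs.v *)
From mathcomp Require Import all_boot all_order all_classical topology.

Set Implicit Arguments.
Unset Strict Implicit.
Unset Printing Implicit Defensive.

Local Open Scope classical_set_scope.
Local Open Scope card_scope.

Section covering_properties.
Variable X : topologicalType.
Implicit Types (A : set X) (U V : set (set X)).

Definition union (V : set (set X)) : set X := \bigcup_(B in V) B.

Definition star (A : set X) (P : set (set X)) : set X :=
  \bigcup_(B in [set B | P B /\ A `&` B !=set0]) B.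

Definition open_cover (U : set (set X)) : Prop :=
  (forall B, U B -> open B) /\ union U = setT.

(* As in the source, [setT] is allowed as a member of an omega-cover. *)
Definition omega_cover (U : set (set X)) : Prop :=
  open_cover U /\
  forall F : set X, finite_set F -> exists2 B, U B & F `<=` B.

Definition lindelof : Prop :=
  forall U, open_cover U ->
  exists V, [/\ V `<=` U, countable V & union V = setT].

Definition star_lindelof : Prop :=
  forall U, open_cover U ->
  exists V, [/\ V `<=` U, countable V & star (union V) U = setT].

Definition star_scheepers : Prop :=
  forall U : nat -> set (set X), (forall n, open_cover (U n)) ->
  exists V : nat -> set (set X),
    (forall n, finite_set (V n) /\ V n `<=` U n) /\
    (omega_cover (range (fun n => star (union (V n)) (U n))) \/
     exists n, star (union (V n)) (U n) = setT).

Definition hurewicz : Prop :=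
  forall U : nat -> set (set X), (forall n, open_cover (U n)) ->
  exists V : nat -> set (set X),
    (forall n, finite_set (V n) /\ V n `<=` U n) /\
    ((forall x, \forall n \near \oo, union (V n) x) \/
     exists n, union (V n) = setT).

Definition star_hurewicz : Prop :=
  forall U : nat -> set (set X), (forall n, open_cover (U n)) ->
  exists V : nat -> set (set X),
    (forall n, finite_set (V n) /\ V n `<=` U n) /\
    ((forall x, \forall n \near \oo, star (union (V n)) (U n) x) \/
     exists n, star (union (V n)) (U n) = setT).

End covering_properties.

Arguments lindelof : clear implicits.
Arguments star_lindelof : clear implicits.
Arguments star_scheepers : clear implicits.
Arguments hurewicz : clear implicits.
Arguments star_hurewicz : clear implicits.

Definition dominating (D : set (nat -> nat)) : Prop :=
  forall g : nat -> nat,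
  exists2 f, D f & \forall n \near \oo, (g n <= f n)%N.

(* The library has no type of cardinals, so a cardinal is represented by a set
   of that cardinality.  The proof is Hönig's argument: a maximal family of
   choice functions that is injective in every coordinate is onto in one. *)
Lemma ex_min_dominating : exists D : set (nat -> nat),
  dominating D /\ forall E, dominating E -> D #<= E.
Proof.
pose I := {E : set (nat -> nat) | dominating E}.
pose good (S : set (I -> nat -> nat)) :=
  (forall p, S p -> forall E : I, sval E (p E)) /\
  (forall p q, S p -> S q -> forall E : I, p E = q E -> p = q).
have [S [[SE Sinj] Smax]] : exists S, good S /\ forall B, S `<` B -> ~ good B.
  apply: Zorn_bigcup => F goodF totF; split.
    by move=> p [A FA Ap]; exact: (goodF A FA).1.
  move=> p q [A FA Ap] [B FB Bq].
  have [AB|BA] := totF A B FA FB.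
    by apply: (goodF B FB).2 => //; exact: AB.
  by apply: (goodF A FA).2 => //; exact: BA.
have [E0 E0P] : exists E0 : I, sval E0 `<=` [set p E0 | p in S].
  apply: contrapT => noE.
  have /choice[p pP] (E : I) : exists x, sval E x /\ ~ [set q E | q in S] x.
    apply: contrapT => nx; apply: noE; exists E => x Ex.
    by apply: contrapT => nSx; apply: nx; exists x.
  have dT : dominating setT by move=> g; exists g => //; exact: nearW.
  have nSp : ~ S p.
    by move=> Sp; apply: (pP (exist _ _ dT)).2; exists p.
  apply: (Smax (S `|` [set p])).
    split; first exact: subsetUl.
    by move=> /(_ p) h; apply/nSp/h; right.
  split; first by move=> q [Sq|->] E; [exact: SE | exact: (pP E).1].
  move=> q r [Sq|->] [Sr|->] E qr //; first exact: Sinj qr.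
    by case: (pP E).2; exists q.
  by case: (pP E).2; exists r.
exists (sval E0); split; first exact: svalP.
move=> E dE; pose E1 : I := exist _ E dE.
apply: card_le_trans (subset_card_le E0P) _.
apply: card_le_trans (card_image_le _ _) _.
have : [set p E1 | p in S] #= S.
  by apply: inj_card_eq => p q /set_mem Sp /set_mem Sq; exact: Sinj.
rewrite card_eq_sym => /card_eqPle[+ _] => /card_le_trans; apply.
by apply: subset_card_le => _ [p Sp <-]; exact: (SE p Sp E1).
Qed.

Definition frakd : set (nat -> nat) := projT1 (cid ex_min_dominating).

Lemma frakdP : dominating frakd /\ forall E, dominating E -> frakd #<= E.
Proof. exact: projT2 (cid ex_min_dominating). Qed.

Definition card_lt (T U : Type) (A : set T) (B : set U) : Prop :=
  A #<= B /\ ~ (B #<= A).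

(* A subset [Y] of [X] used as a type carries the subspace topology. *)
Definition union_of_fewer_than_d (P : topologicalType -> Prop)
    (X : topologicalType) : Prop :=
  exists F : set (set X),
    [/\ card_lt F frakd,
        (forall Y : set X, F Y -> P (set_type Y)) &
        union F = setT].

(* Main.v *)
Require Import Defs.
From mathcomp Require Import all_boot all_order all_classical topology.

(** Each [U n] has a countable subfamily [K n] (in (1) a subcover, in (2) one
    whose union has full star), whose members we code by natural numbers. In
    each piece [Y] the (star-)Hurewicz property selects finite subfamilies of
    the [K n], hence a function [f Y] such that every point of [Y] lies, for
    almost all [n], in the star of the members of [K n] of code at most
    [f Y n]; in (2) the selection is applied to the stars of the members of
    [K n], which cover [Y]. The maxima of finitely many [f Y] are no more
    numerous than the pieces when these are infinite, so they do not dominate: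
    some [g] exceeds each of them infinitely often, and the members of [K n] of
    code at most [g n] form the required selection. *)

Set Implicit Arguments.
Unset Strict Implicit.
Unset Printing Implicit Defensive.

Local Open Scope classical_set_scope.
Local Open Scope card_scope.

(** * Comparison of cardinals through injections *)

Lemma card_le_inj (T U : Type) (A : set T) (B : set U) (f : T -> U) :
  (forall x, A x -> B (f x)) ->
  (forall x y, A x -> A y -> f x = f y -> x = y) -> A #<= B.
Proof.
move=> fAB finj.
have /injfunPex/unsquash g : exists2 g : T -> U, set_fun A B g & set_inj A g.
  by exists f => // x y; rewrite !inE; exact: finj.
exact: inj_card_le g.
Qed.

Lemma card_le_ex_inj (T : Type) (U : pointedType) (A : set T) (B : set U) :
  A #<= B -> exists f : T -> U, (forall x, A x -> B (f x)) /\
    (forall x y, A x -> A y -> f x = f y -> x = y).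
Proof.
move=> /pcard_leP/injfunPex[f fAB finj]; exists f; split=> // x y Ax Ay.
by apply: finj; rewrite inE.
Qed.

(** Induction on [s]: of the member that holds the head and the one that holds the tail, the larger
    holds both. The induction starts at length 1, since an empty [F] has no member to offer. *)
Lemma total_chain_seq (T : eqType) (U : Type) (F : set (set U))
    (h : set U -> set T) (s : seq T) :
  total_on F subset -> (forall A B, A `<=` B -> h A `<=` h B) ->
  s != [::] -> [set` s] `<=` \bigcup_(A in F) h A ->
  exists2 A, F A & [set` s] `<=` h A.
Proof.
move=> totF hmono; elim: s => // x [|y s] IH _ sF.
  have [A FA hA] := sF x (mem_head _ _).
  by exists A => // z /=; rewrite inE => /eqP->.
have [A FA hA] := sF x (mem_head _ _).
have [//|z zs|B FB hB] := IH.
  by apply: sF => /=; rewrite inE zs orbT.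
have [/hmono AB|/hmono BA] := totF A B FA FB.
  exists B => // z /=; rewrite inE => /predU1P[->|zs]; first exact: AB.
  exact: hB.
exists A => // z /=; rewrite inE => /predU1P[->//|zs].
by apply/BA/hB.
Qed.

(** A maximal partial injection, given by its graph [G], is defined on all of [A] or reaches all of
    [B]: otherwise a pair of unmatched points could be added. *)
Lemma card_le_total (T U : pointedType) (A : set T) (B : set U) :
  A #<= B \/ B #<= A.
Proof.
pose P (G : set (T * U)) := [/\ G `<=` A `*` B,
  forall x y z, G (x, y) -> G (x, z) -> y = z &
  forall x y z, G (x, z) -> G (y, z) -> x = y].
have [G [[GAB Gfun Ginj] Gmax]] : exists G, P G /\ forall H, G `<` H -> ~ P H.
  apply: Zorn_bigcup => F FP totF; split.
  - by move=> p [G FG]; have [+ _ _] := FP G FG; apply.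
  - move=> x y z [G FG Gp] [H FH Hp].
    have [GH|HG] := totF G H FG FH.
      by have [_ + _] := FP H FH; apply; [exact: GH Gp|exact: Hp].
    by have [_ + _] := FP G FG; apply; [exact: Gp|exact: HG Hp].
  - move=> x y z [G FG Gp] [H FH Hp].
    have [GH|HG] := totF G H FG FH.
      by have [_ _] := FP H FH; apply; [exact: GH Gp|exact: Hp].
    by have [_ _] := FP G FG; apply; [exact: Gp|exact: HG Hp].
have [domG|ndomG] := pselect (forall x, A x -> exists y, G (x, y)).
  left; 
  have /choice[f fP] x : exists y, A x -> G (x, y).
    by have [/domG[y Gy]|nAx] := pselect (A x); [exists y|exists point].
  apply: (card_le_inj (f := f)); first by move=> x /fP/GAB[].
  by move=> x y /fP Gx /fP + fxy; rewrite -fxy; exact: Ginj.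
right.
have rngG y : B y -> exists x, G (x, y).
  move=> By; apply: contrapT => nG; apply: ndomG => x Ax.
  apply: contrapT => nGx; apply: (Gmax (G `|` [set (x, y)])).
    split; first exact: subsetUl.
    by move=> /(_ (x, y)) h; apply: nGx; exists y; apply: h; right.
  split.
  - by move=> p [/GAB//|->].
  - move=> a b c [Gb|[ax by_]] [Gc|[ax' cy]].
    + exact: Gfun Gb Gc.
    + by case: nGx; exists b; rewrite -ax'.
    + by case: nGx; exists c; rewrite -ax.
    + by rewrite by_ cy.
  - move=> a b c [Ga|[ax cy]] [Gb|[bx cy']].
    + exact: Ginj Ga Gb.
    + by case: nG; exists a; rewrite -cy'.
    + by case: nG; exists b; rewrite -cy.
    + by rewrite ax bx.
have /choice[f fP] y : exists x, B y -> G (x, y).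
  by have [/rngG[x Gx]|nBy] := pselect (B y); [exists x|exists point].
apply: (card_le_inj (f := f)); first by move=> y /fP/GAB[].
by move=> x y /fP Gx /fP + fxy; rewrite -fxy; exact: Gfun.
Qed.

(** * Finite sequences over an infinite set *)

(** Leaving out the empty sequence makes [seqs set0] empty, so that the empty relation is admissible
    in the Zorn argument of [card_seqs_infinite]. *)
Definition seqs (T : eqType) (B : set T) : set (seq T) :=
  [set s | s != [::] /\ [set` s] `<=` B].

Lemma seqs_sub (T : eqType) (B C : set T) : B `<=` C -> seqs B `<=` seqs C.
Proof. by move=> BC s [s0 sB]; split=> //; exact: subset_trans sB BC. Qed.

Lemma seqs1 (T : eqType) (B : set T) (x : T) : seqs B [:: x] <-> B x.
Proof.
split=> [[_]|Bx]; first by apply; exact: mem_head.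
by split=> // y /=; rewrite inE => /eqP->.
Qed.

Lemma card_le_seqs (T : eqType) (U : pointedType) (B : set T) (C : set U) :
  B #<= C -> seqs B #<= seqs C.
Proof.
move=> /card_le_ex_inj[f [fBC finj]]; apply: (card_le_inj (f := map f)).
  move=> s [s0 sB]; split; first by case: s s0 {sB}.
  by move=> y /mapP[x xs ->]; exact/fBC/sB.
move=> s t [_ sB] [_ tB]; elim: s t sB tB => [|x s IH] [|y t] //= sB tB [fxy].
have tl a r : [set` a :: r] `<=` B -> [set` r] `<=` B.
  by move=> h z /= zr; apply: h => /=; rewrite inE zr orbT.
move=> /IH ->; [|exact: tl sB|exact: tl tB].
by congr (_ :: _); apply: finj fxy; [apply: sB|apply: tB]; exact: mem_head.
Qed.

(* A point of [B] becomes a sequence of length 1 and a point of [C] one of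
   length 2, so [B `|` C] embeds into [seqs B]. *)
Lemma card_le_seqsU (T : pointedType) (B C : set T) :
  seqs B #<= B -> C #<= B -> seqs (B `|` C) #<= B.
Proof.
move=> sBB /card_le_ex_inj[j [jCB jinj]].
apply: card_le_trans (sBB); apply/card_le_seqs/(card_le_trans _ sBB).
apply: (card_le_inj (f := fun x => if x \in B then [:: x] else [:: j x; j x])).
  move=> x BCx; case: ifPn => [|/negP]; rewrite inE => Bx; first exact/seqs1.
  have Cx : C x by case: BCx.
  by split=> // z /=; rewrite !inE orbb => /eqP->; exact: jCB.
move=> x y BCx BCy.
case: ifPn => [|/negP]; case: ifPn => [|/negP] //;
  rewrite !inE => By Bx [] // jxy _.
by apply: jinj jxy; [case: BCx|case: BCy].
Qed.

(* A maximal injection [seqs B -> B] with [B] inside [A]: if [A `\` B] had a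
   copy of [B], the injection would extend to their union; hence [A `\` B] is at most
   as large as [B], and [seqs A] is absorbed by [B]. *)
Lemma card_seqs_infinite (T : pointedType) (A : set T) :
  infinite_set A -> seqs A #<= A.
Proof.
move=> infA.
(* [G] is to be the graph of an injection [seqs B -> B]. Its set [B] is read off from the sequences
   of length 1, so Zorn's lemma applies to graphs ordered by plain inclusion. *)
pose fld (G : set (seq T * T)) := [set x | exists y, G ([:: x], y)].
pose P G := [/\ fld G `<=` A,
  forall s y, G (s, y) -> seqs (fld G) s /\ fld G y,
  forall s, seqs (fld G) s -> exists y, G (s, y) &
  forall s t y, G (s, y) -> G (t, y) -> s = t].
have fld_mono G H : G `<=` H -> fld G `<=` fld H.
  by move=> GH x [y Gxy]; exists y; exact: GH.
have [G [[GA Gfld Gtot Ginj] Gmax]] : exists G, P G /\ forall H, G `<` H -> ~ P H.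
  apply: Zorn_bigcup => F FP totF.
  have subF G : F G -> fld G `<=` fld (\bigcup_(G in F) G).
    by move=> FG; apply: fld_mono => p Gp; exists G.
  split.
  - by move=> x [y [G FG Gxy]]; have [+ _ _ _] := FP G FG; apply; exists y.
  - move=> s y [G FG Gsy]; have [_ /(_ _ _ Gsy)[Gs Gy] _ _] := FP G FG.
    by split; [exact: seqs_sub (subF G FG) _ Gs|exact: subF Gy].
  - move=> s [s0 sF]; have sF' : [set` s] `<=` \bigcup_(G in F) fld G.
      by move=> x /sF[y [H FH Hxy]]; exists H => //; exists y.
    have [H FH sH] := total_chain_seq totF fld_mono s0 sF'.
    have [_ _ /(_ s)[//|y Hsy] _] := FP H FH.
    by exists y; exists H.
  - move=> s t y [G FG Gp] [H FH Hp].
    have [GH|HG] := totF G H FG FH.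
      by have [_ _ _] := FP H FH; apply; [exact: GH Gp|exact: Hp].
    by have [_ _ _] := FP G FG; apply; [exact: Gp|exact: HG Hp].
pose B := fld G.
have sBB : seqs B #<= B.
  have /choice[e eP] s : exists y, seqs B s -> G (s, y).
    by have [/Gtot[y Gy]|nBs] := pselect (seqs B s); [exists y|exists point].
  apply: (card_le_inj (f := e)); first by move=> s /eP/Gfld[].
  by move=> s t /eP Gs /eP + est; rewrite -est; exact: Ginj.
(* New sequences would be sent into [C]; as [C] misses [B], no old value is repeated, and a point of
   [C] makes the extension proper. *)
have noext C : C `<=` A `\` B -> C !=set0 -> ~ (seqs (B `|` C) #<= C).
  move=> CAB [c Cc] /card_le_ex_inj[e [eC einj]].
  pose H := G `|` [set p | [/\ seqs (B `|` C) p.1, ~ seqs B p.1 & p.2 = e p.1]].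
  have fldH : fld H = B `|` C.
    apply/seteqP; split=> x.
      by move=> [y [Gxy|[/seqs1//]]]; left; exists y.
    have [[y Gxy] _|nBx [//|Cx]] := pselect (B x); first by exists y; left.
    exists (e [:: x]); right; split=> //; first by apply/seqs1; right.
    by move/seqs1.
  apply: (Gmax H).
    split; first exact: subsetUl.
    move=> /(_ ([:: c], e [:: c])) h.
    have /Gfld[/seqs1 Bc _] : G ([:: c], e [:: c]).
      apply: h; right; split=> //; first by apply/seqs1; right.
      by move=> /seqs1; have [] := CAB c Cc.
    by have [] := CAB c Cc.
  rewrite /P fldH; split.
  - by move=> x [/GA//|/CAB[]].
  - move=> s y [/Gfld[Bs By]|[/= sBC _ ->]].
      by split; [apply: seqs_sub Bs; exact: subsetUl|left].
    by split=> //; right; exact: eC.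
  - move=> s sBC; have [/Gtot[y Gsy]|nBs] := pselect (seqs B s).
      by exists y; left.
    by exists (e s); right.
  - move=> s t y [Gs|[/= sBC _ ye]] [Gt|[/= tBC _ ye']].
    + exact: Ginj Gs Gt.
    + by have [_] := Gfld _ _ Gs; rewrite ye' => /(CAB _ (eC _ tBC)).2.
    + by have [_] := Gfld _ _ Gt; rewrite ye => /(CAB _ (eC _ sBC)).2.
    + by apply: einj => //; rewrite -ye -ye'.
(* If [B] is empty, a copy of [nat] inside [A] serves as [C], its finite sequences being
   countable. *)
have [B0|/set0P B0] := eqVneq B set0.
  move: (infA) => /infiniteP/card_le_ex_inj[i [iA iinj]].
  have cC : range i #= [set: nat] by apply: inj_card_eq => m n _ _; exact: iinj.
  case: (noext (range i)).
  - by rewrite B0 setD0 => _ [n _ <-]; exact: iA.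
  - by exists (i 0%N), 0%N.
  - rewrite B0 set0U; move: cC => /card_eqPle[Cn nC].
    apply: card_le_trans (nC); apply: card_le_trans (card_le_seqs Cn) _.
    exact: countableP.
have [BAB|ABB] := card_le_total B (A `\` B).
  move: BAB => /card_le_ex_inj[j [jAB jinj]].
  have /card_eqPle[CB BC] : j @` B #= B.
    by apply: inj_card_eq => x y; rewrite !inE; exact: jinj.
  case: (noext (j @` B)).
  - by move=> _ [x Bx <-]; exact: jAB.
  - by have [x Bx] := B0; exists (j x), x.
  - by apply: card_le_trans BC; exact: card_le_seqsU.
rewrite -{1}(setDUK GA).
by apply: card_le_trans (subset_card_le GA); exact: card_le_seqsU.
Qed.

(** Otherwise the maxima form a dominating family. For infinite [F] there are at most as many of
    them as members of [F], against [card_lt F frakd]; for finite [F] the maximum over all of [F]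
    plus one lies above each of them everywhere. *)
Lemma frakd_not_finite_max (T : pointedType) (F : set T) (f : T -> nat -> nat) :
  card_lt F frakd ->
  exists g : nat -> nat, forall s, seqs F s ->
    ~ \forall n \near \oo, (g n <= \max_(Y <- s) f Y n)%N.
Proof.
move=> [_ dF]; apply: contrapT => /forallNP nog.
pose E := [set (fun n => \max_(Y <- s) f Y n) | s in seqs F].
have domE : dominating E.
  move=> g; have /existsNP[s /not_implyP[Fs /contrapT gs]] := nog g.
  by exists (fun n => \max_(Y <- s) f Y n) => //; exists s.
have [finF|infF] := pselect (finite_set F); last first.
  apply: dF; apply: card_le_trans (frakdP.2 _ domE) _.
  exact: card_le_trans (card_image_le _ _) (card_seqs_infinite infF).
have /finite_seqP[s FE] := finF.
have [_ [t [_ tF] <-] /= [N _ gt]] := domE (fun n => (\max_(Y <- s) f Y n).+1).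
have := gt N (leqnn N); rewrite /= ltnNge => /negP; apply.
apply/bigmax_leqP_seq => Y tY _; apply: (@leq_bigmax_seq _ s xpredT (f^~ N)) => //.
by have := tF Y tY; rewrite FE.
Qed.

(** * Stars and finite subfamilies of a coded family *)

Lemma star_mono (X : topologicalType) (A B : set X) (P Q : set (set X)) :
  A `<=` B -> P `<=` Q -> star A P `<=` star B Q.
Proof.
move=> AB PQ x [C [PC [y [Ay Cy]]] Cx]; exists C => //; split; first exact: PQ.
by exists y; split=> //; exact: AB.
Qed.

Lemma open_star (X : topologicalType) (A : set X) (U : set (set X)) :
  open_cover U -> open (star A U).
Proof. by move=> [Uo _]; apply: bigcup_open => B [UB _]; exact: Uo. Qed.

Definition coded_below (T : Type) (K : set T) (c : T -> nat) (k : nat) : set T :=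
  [set B | K B /\ (c B <= k)%N].

Lemma coded_below_mono (T : Type) (K : set T) (c : T -> nat) (k m : nat) :
  (k <= m)%N -> coded_below K c k `<=` coded_below K c m.
Proof. by move=> km B [KB ck]; split=> //; exact: leq_trans ck km. Qed.

Lemma finite_coded_below (T : Type) (K : set T) (c : T -> nat) (k : nat) :
  {in K &, injective c} -> finite_set (coded_below K c k).
Proof.
move=> cinj; apply/finite_set_leP; exists k.+1; apply: (card_le_inj (f := c)).
  by move=> B [_ ck]; rewrite /= ltnS.
by move=> B C [KB _] [KC _]; apply: cinj; rewrite inE.
Qed.

Lemma finite_sub_coded_below (T : Type) (K : set T) (c : T -> nat) (V : set T) :
  finite_set V -> V `<=` K -> exists k, V `<=` coded_below K c k.
Proof.
move=> finV VK.
have /finite_seqP[s sE] : finite_set (c @` V) by exact: finite_image.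
exists (\max_(i <- s) i) => B VB; split; first exact: VK.
apply: (@leq_bigmax_seq _ s xpredT id) => //.
by have : [set` s] (c B) by rewrite -sE; exists B.
Qed.

(** Turns a finite selection of traces on a piece, or of traces of stars, back into a finite
    selection from [K n]. *)
Lemma finite_sub_image (T U : Type) (K : set T) (h : T -> U) (V : set U) :
  finite_set V -> V `<=` h @` K ->
  exists W, [/\ finite_set W, W `<=` K & V `<=` h @` W].
Proof.
move=> finV VK.
have [K0|/set0P[B0 _]] := eqVneq K set0.
  by exists set0; split=> //; rewrite -K0.
have /choice[p pP] E : exists B, V E -> K B /\ h B = E.
  have [/VK[B KB <-]|nVE] := pselect (V E); first by exists B.
  by exists B0.
exists (p @` V); split; first exact: finite_image.
  by move=> _ [E /pP[+ _] <-].
by move=> E VE; exists (p E); [exists E|exact: (pP E VE).2].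
Qed.

Lemma near_forall_seq (T : eqType) (s : seq T) (P : nat -> T -> Prop) :
  (forall x, x \in s -> \forall n \near \oo, P n x) ->
  \forall n \near \oo, forall x, x \in s -> P n x.
Proof.
elim: s => [_|x s IH sP]; first by apply: nearW => n x; rewrite in_nil.
have Px : \forall n \near \oo, P n x by apply: sP; exact: mem_head.
have Ps : \forall n \near \oo, forall y, y \in s -> P n y.
  by apply: IH => y ys; apply: sP; rewrite inE ys orbT.
near=> n => y; rewrite inE => /predU1P[->|].
  by near: n.
by move: y; near: n.
Unshelve. all: by end_near. Qed.

(** * From the pieces to the whole space *)

(** Common core of both claims: the pieces enter only through selections from [K n], with all stars
    taken in [X]. *)
Lemma star_scheepers_of_fewer_than_d (X : topologicalType) (F : set (set X))
    (U K : nat -> set (set X)) :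
  card_lt F frakd -> union F = setT ->
  (forall n, open_cover (U n)) ->
  (forall n, K n `<=` U n) -> (forall n, countable (K n)) ->
  (forall Y, F Y -> exists V : nat -> set (set X),
    (forall n, finite_set (V n) /\ V n `<=` K n) /\
    forall x, Y x -> \forall n \near \oo, star (union (V n)) (U n) x) ->
  exists V : nat -> set (set X),
    (forall n, finite_set (V n) /\ V n `<=` U n) /\
    omega_cover (range (fun n => star (union (V n)) (U n))).
Proof.
move=> Fd FX Uc KU Kcount FK.
have /choice[c cinj] n : exists c : set X -> nat, {in K n &, injective c}.
  exact/countable_injP.
have /choice[f fP] Y : exists f : nat -> nat, F Y -> forall x, Y x ->
    \forall n \near \oo, star (union (coded_below (K n) (c n) (f n))) (U n) x.
  have [/FK[V [VK Vcov]]|nFY] := pselect (F Y); last by exists (fun=> 0%N).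
  have /choice[f fP] n : exists k, V n `<=` coded_below (K n) (c n) k.
    by have [finV VKn] := VK n; exact: finite_sub_coded_below.
  exists f => _ x /Vcov; apply: filterS => n; apply: star_mono => //.
  exact: bigcup_subset.
have /choice[Y YP] x : exists Y, F Y /\ Y x.
  by have : [set: X] x by []; rewrite -FX => -[Y FY Yx]; exists Y.
have [g gP] := frakd_not_finite_max f Fd.
pose V n := coded_below (K n) (c n) (g n); exists V; split.
  move=> n; split; first exact: finite_coded_below.
  by move=> B [KB _]; exact: KU.
have finP (A : set X) : finite_set A -> exists n,
    A `<=` star (union (V n)) (U n).
  (* The empty set is treated apart because [seqs] omits the empty sequence. *)
  move=> /finite_seqP[s ->]; have [->|s0] := eqVneq s [::].
    by exists 0%N => x /=; rewrite in_nil.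
  apply: contrapT => /forallNP nog.
  have sF : seqs F (map Y s).
    split; first by case: (s) s0.
    by move=> _ /mapP[x _ ->]; exact: (YP x).1.
  apply: (gP _ sF).
  have sP : \forall n \near \oo, forall x, x \in s ->
      star (union (coded_below (K n) (c n) (f (Y x) n))) (U n) x.
    by apply: near_forall_seq => x _; have [FYx Yx] := YP x; exact: fP FYx _ Yx.
  (* If [g n] exceeded the maximum, [V n] would contain the families coded for the pieces of all
     points of [s], and its star would contain [s], against [nog]. *)
  apply: filterS sP => n sn; rewrite leqNgt; apply/negP => gn.
  apply: (nog n) => x /= xs; apply: star_mono (sn x xs) => //.
  apply: bigcup_subset; apply: coded_below_mono; apply: leq_trans (ltnW gn).
  by rewrite big_map; exact: (@leq_bigmax_seq _ s xpredT (fun x => f (Y x) n)).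
split; last first.
  by move=> A /finP[n An]; exists (star (union (V n)) (U n)) => //; exists n.
split; first by move=> _ [n _ <-]; exact: open_star.
rewrite -subTset => x _; have [n xn] := finP [set x] (finite_set1 x).
by exists (star (union (V n)) (U n)); [exists n|exact: xn].
Qed.

(* If no finite selection from some [U k] covers [Y], then [U k] replaces each
   [U n] having one that does; this leaves only the first alternative of the hypothesis. *)
Lemma selection_eventually (Y : topologicalType)
    (cov : set (set Y) -> set (set Y) -> set Y) :
  (forall U, (forall n : nat, open_cover (U n)) -> exists V,
    (forall n, finite_set (V n) /\ V n `<=` U n) /\
    ((forall x, \forall n \near \oo, cov (V n) (U n) x) \/
     exists n, cov (V n) (U n) = setT)) ->
  forall U, (forall n : nat, open_cover (U n)) -> exists V,
    (forall n, finite_set (V n) /\ V n `<=` U n) /\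
    forall x, \forall n \near \oo, cov (V n) (U n) x.
Proof.
move=> H U Uc.
pose S n W := [/\ finite_set W, W `<=` U n & cov W (U n) = setT].
have [allS|/existsNP[k nSk]] := pselect (forall n, exists W, S n W).
  have [V VP] := choice allS; exists V; split; first by move=> n; have [] := VP n.
  by move=> x; apply: nearW => n; have [_ _ ->] := VP n.
have /choice[r rP] n : exists m,
    (~ exists W, S m W) /\ ((exists W, S n W) \/ m = n).
  have [Sn|nSn] := pselect (exists W, S n W); first by exists k; split=> //; left.
  by exists n; split=> //; right.
have [V' [V'U [V'cov|[n V'T]]]] := H (fun n => U (r n)) (fun n => Uc (r n)).
  (* A full selection is used where there is one; elsewhere [r n = n], so [V' n] is a selection from
     [U n] itself. *)
  have /choice[V VP] n : exists W, S n W \/ W = V' n /\ r n = n.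
    by have [_ [[W SW]|rn]] := rP n; [exists W; left|exists (V' n); right].
  exists V; split.
    by move=> n; have [[]//|[-> rn]] := VP n; have := V'U n; rewrite rn.
  move=> x; apply: filterS (V'cov x) => n.
  by have [[_ _ ->]//|[-> ->]] := VP n.
(* The second alternative is impossible: [r n] is an index without a full selection. *)
by have [+ _] := rP n; case; exists (V' n); split=> //; have [] := V'U n.
Qed.

Lemma open_cover_preimage (X : topologicalType) (Y : set X) (U : set (set X)) :
  (forall B, U B -> open B) -> union U = setT ->
  open_cover [set (set_val @^-1` B : set (set_type Y)) | B in U].
Proof.
move=> Uo UX; split.
  have /continuousP valc : continuous (set_val : set_type Y -> X).
    exact: initial_continuous.
  by move=> _ [B /Uo oB <-]; exact: valc.
rewrite -subTset => y _.
have : [set: X] (set_val y) by [].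
by rewrite -UX => -[B UB By]; exists (set_val @^-1` B) => //; exists B.
Qed.

Theorem theorem3p28 (X : topologicalType) :
  (lindelof X -> union_of_fewer_than_d star_hurewicz X -> star_scheepers X) /\
  (star_lindelof X -> union_of_fewer_than_d hurewicz X -> star_scheepers X).
Proof.
split=> XL [F [Fd FP FX]] U Uc; have /choice[K KP] n := XL _ (Uc n).
  have KU n : K n `<=` U n by have [] := KP n.
  have [|Y FY|V [VU Vo]] := star_scheepers_of_fewer_than_d Fd FX Uc KU.
  - by move=> n; have [] := KP n.
  - have [|V [VT Vcov]] := selection_eventually
      (cov := fun V U => star (union V) U) (FP Y FY)
      (U := fun n => [set set_val @^-1` B | B in K n]).
      move=> n; have [_ _ KX] := KP n; apply: open_cover_preimage => // B /KU.
      exact: (Uc n).1.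
    have /choice[W WP] n : exists W, [/\ finite_set W, W `<=` K n &
        V n `<=` [set set_val @^-1` B | B in W]].
      by have [] := VT n; exact: finite_sub_image.
    exists W; split=> [n|x Yx]; first by have [] := WP n.
    apply: filterS (Vcov (SigSub (mem_set Yx))) => n.
    (* Traces that meet in [Y] come from sets that meet in [X], so the star formed inside [Y] lies
       in the star taken in [X]. *)
    move=> [_ [[B KB <-] [y [[E VE Ey] By]]] Bx].
    have [_ _ /(_ E VE)[C WC CE]] := WP n.
    exists B => //; split; first exact: KU.
    by exists (set_val y); split=> //; exists C => //; rewrite -CE in Ey.
  - by exists V; split=> //; left.
have KU n : K n `<=` U n by have [] := KP n.
have [|Y FY|V [VU Vo]] := star_scheepers_of_fewer_than_d Fd FX Uc KU.
- by move=> n; have [] := KP n.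
(* These stars cover [X] because the union of [K n] has full star, and a union of selected stars
   lies in the star of the union of the sets they come from. *)
- pose stK n := [set star B (U n) | B in K n].
  have [|V [VT Vcov]] := selection_eventually
    (cov := fun V _ => union V) (FP Y FY)
    (U := fun n => [set set_val @^-1` B | B in stK n]).
    move=> n; have [_ _ KX] := KP n; apply: open_cover_preimage.
      by move=> _ [B _ <-]; exact: open_star.
    rewrite -subTset -KX => x [D [UD [y [[B KB By] Dy]]] Dx].
    by exists (star B (U n)); [exists B|exists D => //; split=> //; exists y].
  have /choice[W WP] n : exists W, [/\ finite_set W, W `<=` K n &
      V n `<=` [set set_val @^-1` star B (U n) | B in W]].
    have [finV VK] := VT n; apply: finite_sub_image finV _.
    by move=> E /VK[_ [B KB <-] <-]; exists B.
  exists W; split=> [n|x Yx]; first by have [] := WP n.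
  apply: filterS (Vcov (SigSub (mem_set Yx))) => n [E VE Ex].
  have [_ _ /(_ E VE)[B WB BE]] := WP n.
  by rewrite -BE in Ex; apply: star_mono Ex => // y By; exists B.
- by exists V; split=> //; left.
Qed.
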